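(* Consider the FDTD (Yee-grid) model, described in the context, of a plane harmonic wave normally incident on a planar interface between two dielectrics with relative permittivities $\varepsilon_1,\varepsilon_2$ and common relative permeability $\mu$. The FDTD analogs $\widetilde t,\widetilde r$ of the Fresnel transmission and reflection coefficients for this interface, i.e. the coefficients determined by the interface conditions (a) and (b) of the context with numerical wavenumbers $\widetilde k_1,\widetilde k_2$ given by the Yee dispersion relation, are $$ \widetilde{t}=\frac{2\eta_2\cos\left(\frac{\widetilde{k}_1\Delta_x}{2}\right)}{\eta_2\cos\left(\frac{\widetilde{k}_2\Delta_x}{2}\right)+\eta_1\cos\left(\frac{\widetilde{k}_1\Delta_x}{2}\right)},\qquad \widetilde{r}=\frac{\eta_2\cos\left(\frac{\widetilde{k}_2\Delta_x}{2}\right)-\eta_1\cos\left(\frac{\widetilde{k}_1\Delta_x}{2}\right)}{\eta_2\cos\left(\frac{\widetilde{k}_2\Delta_x}{2}\right)+\eta_1\cos\left(\frac{\widetilde{k}_1\Delta_x}{2}\right)}. $$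
   Context: Media: both media are lossless, linear, homogeneous, isotropic and stationary, with real positive constants $\varepsilon_1,\varepsilon_2,\mu$; there are no external currents or free charges, including on the interface. $\varepsilon_0,\mu_0$ are the vacuum permittivity and permeability, $c=1/\sqrt{\varepsilon_0\mu_0}$. The grid has time step $\Delta_t$ and space step $\Delta_x$; the Courant number is $S_{\mathrm c}=c\Delta_t/\Delta_x$. For $j=1,2$, medium $j$ has refractive index $n_{j}=\sqrt{\varepsilon_j\mu}$ and impedance $\eta_j=\sqrt{\mu_0/\varepsilon_0}\,\sqrt{\mu/\varepsilon_j}$. The wave has angular frequency $\omega$, and the numerical wavenumber $\widetilde k_j$ in medium $j$ is determined by the Yee dispersion relation $\sin(\widetilde k_j\Delta_x/2)=\frac{n_j}{S_{\mathrm c}}\sin(\omega\Delta_t/2)$. Let $\xi\in\frac12\mathbb{Z}$ denote position in units of $\Delta_x$ relative to the interface ($\xi=0$; medium 1 is $\xi<0$, medium 2 is $\xi>0$) and $q\in\frac12\mathbb{Z}$ time in units of $\Delta_t$. The discrete fields, with $E_0$ the amplitude of the incident wave, are incident: $E^{(i)\,q}[\xi]=E_0e^{i(\omega q\Delta_t-\widetilde k_1\xi\Delta_x)}$, $H^{(i)\,q}[\xi]=-\frac{E_0}{\eta_1}e^{i(\omega q\Delta_t-\widetilde k_1\xi\Delta_x)}$; reflected: $E^{(r)\,q}[\xi]=\widetilde rE_0e^{i(\omega q\Delta_t+\widetilde k_1\xi\Delta_x)}$, $H^{(r)\,q}[\xi]=\widetilde r\frac{E_0}{\eta_1}e^{i(\omega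 q\Delta_t+\widetilde k_1\xi\Delta_x)}$; transmitted: $E^{(t)\,q}[\xi]=\widetilde tE_0e^{i(\omega q\Delta_t-\widetilde k_2\xi\Delta_x)}$, $H^{(t)\,q}[\xi]=-\widetilde t\frac{E_0}{\eta_2}e^{i(\omega q\Delta_t-\widetilde k_2\xi\Delta_x)}$. Dielectric interface model: the interface $\xi=0$ is a magnetic-field node of the Yee grid; the nearest electric nodes $\xi=-\frac12$ and $\xi=+\frac12$ lie strictly in media 1 and 2. Write $E^q[-\tfrac12]=E^{(i)\,q}[-\tfrac12]+E^{(r)\,q}[-\tfrac12]$ and $E^q[\tfrac12]=E^{(t)\,q}[\tfrac12]$. The interface conditions are: (a) (continuity of the tangential magnetic field) $H^{(i)\,q}[0]+H^{(r)\,q}[0]=H^{(t)\,q}[0]$, with $H^q[0]$ denoting this common value; after cancelling $E_0e^{i\omega q\Delta_t}$ this reads $-\frac1{\eta_1}+\frac{\widetilde r}{\eta_1}=-\frac{\widetilde t}{\eta_2}$; (b) (discrete Faraday law at the interface node) $\mu_0\mu\,\dfrac{H^{q+1/2}[0]-H^{q-1/2}[0]}{\Delta_t}=\dfrac{E^q[\frac12]-E^q[-\frac12]}{\Delta_x}$; after cancelling $E_0e^{i\omega q\Delta_t}$ this reads $e^{i\widetilde k_1\Delta_x/2}+\widetilde r\,e^{-i\widetilde k_1\Delta_x/2}=\left(e^{-i\widetilde k_2\Delta_x/2}+i\frac{\Omega\mu_0\mu\Delta_x}{\eta_2}\right)\widetilde t$, where $\Omega=\frac{2}{\Delta_t}\sin\left(\frac{\omega\Delta_t}{2}\right)$.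 *)

(* Defs.v *)
From Stdlib Require Import Reals Lra.
From Coquelicot Require Import Coquelicot.
Open Scope R_scope.

Definition Cexp (z : C) : C :=
  (exp (fst z) * cos (snd z), exp (fst z) * sin (snd z)).
Definition Ccos (z : C) : C := ((Cexp (Ci * z) + Cexp (- (Ci * z))) / 2)%C.
Definition Csin (z : C) : C := ((Cexp (Ci * z) - Cexp (- (Ci * z))) / (2 * Ci))%C.

Definition half_integer (x : R) : Prop := exists m : Z, x = IZR m / 2.

Definition light_speed (eps0 mu0 : R) : R := 1 / sqrt (eps0 * mu0).
Definition courant (eps0 mu0 dt dx : R) : R := light_speed eps0 mu0 * dt / dx.
Definition refractive_index (eps mu : R) : R := sqrt (eps * mu).
Definition impedance (eps0 mu0 eps mu : R) : R :=
  sqrt (mu0 / eps0) * sqrt (mu / eps).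

(* The wavenumber is complex: since n / S_c >= 1 may occur, the right-hand side
   can exceed 1, and then the wave is evanescent. No branch is selected. *)
Definition yee_dispersion (eps0 mu0 eps mu dt dx omega : R) (k : C) : Prop :=
  Csin (k * dx / 2)%C =
  RtoC (refractive_index eps mu / courant eps0 mu0 dt dx * sin (omega * dt / 2)).

(* Time q is counted in units of dt and position xi in units of dx; only
   half-integer values of q and xi are grid nodes. *)
Definition phase_right (dt dx omega : R) (k : C) (q xi : R) : C :=
  Cexp (Ci * (RtoC (omega * q * dt) - k * RtoC (xi * dx)))%C.
Definition phase_left (dt dx omega : R) (k : C) (q xi : R) : C :=
  Cexp (Ci * (RtoC (omega * q * dt) + k * RtoC (xi * dx)))%C.

Definition E_inc (dt dx omega : R) (E0 k1 : C) (q xi : R) : C :=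
  (E0 * phase_right dt dx omega k1 q xi)%C.
Definition H_inc (dt dx omega eta1 : R) (E0 k1 : C) (q xi : R) : C :=
  (- (E0 / eta1) * phase_right dt dx omega k1 q xi)%C.

Definition E_refl (dt dx omega : R) (E0 k1 r : C) (q xi : R) : C :=
  (r * E0 * phase_left dt dx omega k1 q xi)%C.
Definition H_refl (dt dx omega eta1 : R) (E0 k1 r : C) (q xi : R) : C :=
  (r * (E0 / eta1) * phase_left dt dx omega k1 q xi)%C.

Definition E_trans (dt dx omega : R) (E0 k2 t : C) (q xi : R) : C :=
  (t * E0 * phase_right dt dx omega k2 q xi)%C.
Definition H_trans (dt dx omega eta2 : R) (E0 k2 t : C) (q xi : R) : C :=
  (- (t * (E0 / eta2)) * phase_right dt dx omega k2 q xi)%C.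

Definition discrete_faraday (mu0 mu dt dx : R) (H0 Eminus Eplus : R -> C) : Prop :=
  forall q : R, half_integer q ->
    (RtoC (mu0 * mu) * ((H0 (q + 1 / 2)%R - H0 (q - 1 / 2)%R) / dt) =
     (Eplus q - Eminus q) / dx)%C.

(* [H0] is the common value of the magnetic field at the interface node xi = 0. *)
Definition interface_conditions (mu0 mu dt dx omega eta1 eta2 : R)
    (E0 k1 k2 t r : C) : Prop :=
  exists H0 : R -> C,
    (forall q : R, half_integer q ->
       (H_inc dt dx omega eta1 E0 k1 q 0 + H_refl dt dx omega eta1 E0 k1 r q 0)%C
         = H0 q /\
       H_trans dt dx omega eta2 E0 k2 t q 0 = H0 q) /\
    discrete_faraday mu0 mu dt dx H0
      (fun q => (E_inc dt dx omega E0 k1 q (- (1 / 2))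
                 + E_refl dt dx omega E0 k1 r q (- (1 / 2)))%C)
      (fun q => E_trans dt dx omega E0 k2 t q (1 / 2)).

Definition fresnel_denominator (dx eta1 eta2 : R) (k1 k2 : C) : C :=
  (eta2 * Ccos (k2 * dx / 2) + eta1 * Ccos (k1 * dx / 2))%C.

Lemma Ccos_RtoC (x : R) : Ccos (RtoC x) = RtoC (cos x).
Proof.
unfold Ccos, Cexp, Ci, RtoC, Cdiv, Cinv, Cmult, Cplus, Copp; simpl.
replace (0 * x - 1 * 0) with 0 by ring.
replace (0 * 0 + 1 * x) with x by ring.
rewrite Ropp_0, exp_0, cos_neg, sin_neg.
apply injective_projections; simpl; field.
Qed.

(* The denominator vanishes for no pair of propagating waves, i.e. real
   wavenumbers strictly below the grid cut-off. *)
Lemma fresnel_denominator_neq0 (dx eta1 eta2 k1 k2 : R) :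
  0 < eta1 -> 0 < eta2 ->
  - PI < k1 * dx < PI -> - PI < k2 * dx < PI ->
  fresnel_denominator dx eta1 eta2 k1 k2 <> RtoC 0.
Proof.
intros h1 h2 hk1 hk2; unfold fresnel_denominator.
replace (RtoC k1 * RtoC dx / 2)%C with (RtoC (k1 * dx / 2))
  by (rewrite RtoC_div, RtoC_mult; easy || lra).
replace (RtoC k2 * RtoC dx / 2)%C with (RtoC (k2 * dx / 2))
  by (rewrite RtoC_div, RtoC_mult; easy || lra).
rewrite !Ccos_RtoC, <- !RtoC_mult, <- RtoC_plus.
intros H; apply RtoC_inj in H.
assert (c1 : 0 < cos (k1 * dx / 2)) by (apply cos_gt_0; lra).
assert (c2 : 0 < cos (k2 * dx / 2)) by (apply cos_gt_0; lra).
assert (0 < eta2 * cos (k2 * dx / 2)) by now apply Rmult_lt_0_compat.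
assert (0 < eta1 * cos (k1 * dx / 2)) by now apply Rmult_lt_0_compat.
lra.
Qed.

(* Main.v *)
(** Cancelling the common factor [E0 e^(i omega q dt)], the interface conditions
    become a linear system in [t] and [r]. With [C_j], [S_j] the cosine and sine
    of [k_j dx / 2], the dispersion relation identifies the coefficient
    [Omega mu0 mu dx / eta2] with [2 S_2], so condition (b) reads
    [(1 + r) C_1 + i (1 - r) S_1 = t (C_2 + i S_2)]. The dispersion relations
    also give [eta1 S_1 = eta2 S_2]; hence, by condition (a), the sine terms
    cancel and [(1 + r) C_1 = t C_2] remains. *)

Require Import Defs.
From Stdlib Require Import Reals Lra.
From Coquelicot Require Import Coquelicot.
Open Scope R_scope.

(** * Complex exponential, sine and cosine *)

Lemma Ci_neq0 : Ci <> RtoC 0.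
Proof. intros H; injection H; lra. Qed.

Lemma two_neq0 : RtoC 2 <> RtoC 0.
Proof. intros H; apply RtoC_inj in H; lra. Qed.

Lemma Cexp_add (z w : C) : Cexp (z + w) = (Cexp z * Cexp w)%C.
Proof.
unfold Cexp; apply injective_projections; simpl;
  rewrite exp_plus, ?cos_plus, ?sin_plus; ring.
Qed.

Lemma Cexp_0 : Cexp (RtoC 0) = RtoC 1.
Proof.
unfold Cexp; apply injective_projections; simpl;
  rewrite exp_0, ?cos_0, ?sin_0; ring.
Qed.

Lemma Cexp_neq0 (z : C) : Cexp z <> RtoC 0.
Proof.
intros H; apply C1_nz.
rewrite <- Cexp_0, <- (Cplus_opp_r z), Cexp_add, H; ring.
Qed.

Lemma Cexp_Ci (z : C) : Cexp (Ci * z) = (Ccos z + Ci * Csin z)%C.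
Proof. unfold Ccos, Csin; field; auto using Ci_neq0, two_neq0. Qed.

Lemma Cexp_opp_Ci (z : C) : Cexp (- (Ci * z)) = (Ccos z - Ci * Csin z)%C.
Proof. unfold Ccos, Csin; field; auto using Ci_neq0, two_neq0. Qed.

(** Euler's formula in its real and complex forms gives two values of [Cexp (Ci * x)]; their cosine
    parts agree by [Ccos_RtoC], hence so do their sine parts. *)
Lemma Csin_RtoC (x : R) : Csin (RtoC x) = RtoC (sin x).
Proof.
assert (H : Cexp (Ci * x) = (RtoC (cos x) + Ci * RtoC (sin x))%C).
{ unfold Cexp; apply injective_projections; simpl;
    replace (0 * x - 1 * 0) with 0 by ring;
    replace (0 * 0 + 1 * x) with x by ring; rewrite exp_0; ring. }
rewrite Cexp_Ci, Ccos_RtoC in H.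
transitivity ((Ccos x + Ci * Csin x - Ccos x) / Ci)%C;
  [| rewrite Ccos_RtoC, H]; field; apply Ci_neq0.
Qed.

(** * Impedance and the Yee dispersion relation *)

Lemma impedance_gt0 (eps0 mu0 eps mu : R) :
  0 < eps0 -> 0 < mu0 -> 0 < eps -> 0 < mu -> 0 < impedance eps0 mu0 eps mu.
Proof.
intros; unfold impedance.
apply Rmult_lt_0_compat; apply sqrt_lt_R0, Rdiv_lt_0_compat; assumption.
Qed.

(** Both sides equal [sqrt (eps0 * mu0 * eps * mu) * dx / dt]. *)
Lemma index_over_courant (eps0 mu0 eps mu dt dx : R) :
  0 < eps0 -> 0 < mu0 -> 0 < eps -> 0 < mu -> 0 < dt -> 0 < dx ->
  refractive_index eps mu / courant eps0 mu0 dt dx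
    = mu0 * mu * dx / (dt * impedance eps0 mu0 eps mu).
Proof.
intros he0 hm0 he hm ht hx.
unfold refractive_index, courant, light_speed, impedance.
rewrite !sqrt_div, !sqrt_mult by lra.
pose proof (sqrt_lt_R0 _ he0); pose proof (sqrt_lt_R0 _ hm0).
pose proof (sqrt_lt_R0 _ he); pose proof (sqrt_lt_R0 _ hm).
(* With [mu0 * mu] written through square roots, [field] can treat the roots as atoms. *)
replace (mu0 * mu) with (sqrt mu0 * sqrt mu0 * (sqrt mu * sqrt mu))
  by (rewrite !sqrt_sqrt; lra).
field; repeat split; lra.
Qed.

(** The right-hand side is free of [eps], so impedance times sine takes the same value in both
    media. *)
Lemma yee_dispersion_impedance (eps0 mu0 eps mu dt dx omega : R) (k : C) :
  0 < eps0 -> 0 < mu0 -> 0 < eps -> 0 < mu -> 0 < dt -> 0 < dx ->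
  yee_dispersion eps0 mu0 eps mu dt dx omega k ->
  (impedance eps0 mu0 eps mu * Csin (k * dx / 2))%C
    = RtoC (mu0 * mu * dx / dt * sin (omega * dt / 2)).
Proof.
intros he0 hm0 he hm ht hx Hk.
pose proof (impedance_gt0 eps0 mu0 eps mu he0 hm0 he hm).
rewrite Hk, index_over_courant, <- RtoC_mult by assumption.
f_equal; field; lra.
Qed.

(** * Plane-wave phases at the grid nodes *)

Lemma phase_right_split (dt dx omega : R) (k : C) (q xi : R) :
  phase_right dt dx omega k q xi
    = (Cexp (Ci * RtoC (omega * q * dt)) * Cexp (- (Ci * (k * RtoC (xi * dx)))))%C.
Proof. unfold phase_right; rewrite <- Cexp_add; f_equal; ring. Qed.

Lemma phase_left_split (dt dx omega : R) (k : C) (q xi : R) :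
  phase_left dt dx omega k q xi
    = (Cexp (Ci * RtoC (omega * q * dt)) * Cexp (Ci * (k * RtoC (xi * dx))))%C.
Proof. unfold phase_left; rewrite <- Cexp_add; f_equal; ring. Qed.

Lemma phase_right_node0 (dt dx omega : R) (k : C) (q : R) :
  phase_right dt dx omega k q 0 = Cexp (Ci * RtoC (omega * q * dt)).
Proof. unfold phase_right; rewrite Rmult_0_l; f_equal; ring. Qed.

Lemma phase_left_node0 (dt dx omega : R) (k : C) (q : R) :
  phase_left dt dx omega k q 0 = Cexp (Ci * RtoC (omega * q * dt)).
Proof. unfold phase_left; rewrite Rmult_0_l; f_equal; ring. Qed.

Lemma half_cell (k : C) (dx : R) : (k * RtoC (1 / 2 * dx) = k * dx / 2)%C.
Proof.
rewrite RtoC_mult, RtoC_div by lra; field; apply two_neq0.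
Qed.

Lemma half_cell_opp (k : C) (dx : R) :
  (k * RtoC (- (1 / 2) * dx) = - (k * dx / 2))%C.
Proof.
rewrite <- half_cell.
replace (- (1 / 2) * dx) with (- (1 / 2 * dx)) by ring.
rewrite RtoC_opp; ring.
Qed.

Lemma time_phase_central_difference (dt omega q : R) :
  (Cexp (Ci * RtoC (omega * (q + 1 / 2) * dt))
     - Cexp (Ci * RtoC (omega * (q - 1 / 2) * dt))
   = Cexp (Ci * RtoC (omega * q * dt)) * (2 * Ci * RtoC (sin (omega * dt / 2))))%C.
Proof.
replace (omega * (q + 1 / 2) * dt) with (omega * q * dt + omega * dt / 2) by field.
replace (omega * (q - 1 / 2) * dt) with (omega * q * dt - omega * dt / 2) by field.
rewrite RtoC_plus, RtoC_minus.
unfold Cminus; rewrite !Cmult_plus_distr_l, !Cexp_add.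
replace (Ci * - RtoC (omega * dt / 2))%C with (- (Ci * RtoC (omega * dt / 2)))%C by ring.
rewrite (Cexp_Ci (RtoC (omega * dt / 2))), Cexp_opp_Ci, Csin_RtoC; ring.
Qed.

(** * Reduction of the interface conditions to a linear system *)

Lemma half_integer_0 : half_integer 0.
Proof. exists 0%Z; field. Qed.

Lemma Cmult_eq_reg_l (a b c : C) : a <> RtoC 0 -> (a * b = a * c)%C -> b = c.
Proof.
intros Ha H.
transitivity (/ a * (a * b))%C; [field; exact Ha | rewrite H; field; exact Ha].
Qed.

(** Every field carries the nonzero factor [E0 * T q], so the conditions at all times amount to
    those at [q = 0]. The two equations are (a) and (b) cleared of the impedances in their
    denominators. *)
Lemma interface_conditions_reduced
    (mu0 mu dt dx omega eta1 eta2 : R) (E0 k1 k2 t r : C) :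
  dt <> 0 -> dx <> 0 -> eta1 <> 0 -> eta2 <> 0 -> E0 <> RtoC 0 ->
  interface_conditions mu0 mu dt dx omega eta1 eta2 E0 k1 k2 t r <->
  (eta2 * (1 - r) = eta1 * t)%C /\
  (eta2 * (Cexp (Ci * (k1 * dx / 2)) + r * Cexp (- (Ci * (k1 * dx / 2))))
   = (eta2 * Cexp (- (Ci * (k2 * dx / 2)))
      + 2 * Ci * RtoC (mu0 * mu * dx / dt * sin (omega * dt / 2))) * t)%C.
Proof.
intros ht hx h1 h2 hE.
assert (ht' : RtoC dt <> RtoC 0) by (intros H; now apply RtoC_inj in H).
assert (hx' : RtoC dx <> RtoC 0) by (intros H; now apply RtoC_inj in H).
assert (h1' : RtoC eta1 <> RtoC 0) by (intros H; now apply RtoC_inj in H).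
assert (h2' : RtoC eta2 <> RtoC 0) by (intros H; now apply RtoC_inj in H).
assert (Hcoef : RtoC (mu0 * mu * dx / dt * sin (omega * dt / 2))
  = (RtoC (mu0 * mu) * dx / dt * RtoC (sin (omega * dt / 2)))%C).
{ now rewrite RtoC_mult, RtoC_div, RtoC_mult by assumption. }
rewrite Hcoef; clear Hcoef.
set (T := fun q : R => Cexp (Ci * RtoC (omega * q * dt))).
set (s := RtoC (sin (omega * dt / 2))).
set (u1 := Cexp (Ci * (k1 * dx / 2))).
set (v1 := Cexp (- (Ci * (k1 * dx / 2)))).
set (v2 := Cexp (- (Ci * (k2 * dx / 2)))).
assert (HT : forall q, T q <> RtoC 0) by (intros q; apply Cexp_neq0).
assert (Hdiff : forall q, (T (q + 1 / 2)%R - T (q - 1 / 2)%R = T q * (2 * Ci * s))%C)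
  by (intros q; apply time_phase_central_difference).
assert (Hm : forall q, (E_inc dt dx omega E0 k1 q (- (1 / 2))
    + E_refl dt dx omega E0 k1 r q (- (1 / 2)) = E0 * T q * (u1 + r * v1))%C).
{ intros q; unfold E_inc, E_refl.
  rewrite phase_right_split, phase_left_split, half_cell_opp.
  replace (- (Ci * - (k1 * dx / 2)))%C with (Ci * (k1 * dx / 2))%C by ring.
  replace (Ci * - (k1 * dx / 2))%C with (- (Ci * (k1 * dx / 2)))%C by ring.
  fold u1 v1 (T q); ring. }
assert (Hp : forall q, E_trans dt dx omega E0 k2 t q (1 / 2) = (E0 * T q * (t * v2))%C).
{ intros q; unfold E_trans.
  rewrite phase_right_split, half_cell; fold v2 (T q); ring. }
assert (Ha : forall q, (H_inc dt dx omega eta1 E0 k1 q 0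
    + H_refl dt dx omega eta1 E0 k1 r q 0 = E0 * T q * ((r - 1) / eta1))%C).
{ intros q; unfold H_inc, H_refl.
  rewrite phase_right_node0, phase_left_node0; fold (T q); field; assumption. }
assert (Hb : forall q, H_trans dt dx omega eta2 E0 k2 t q 0
    = (E0 * T q * (- t / eta2))%C).
{ intros q; unfold H_trans.
  rewrite phase_right_node0; fold (T q); field; assumption. }
assert (Hfar : forall q, (RtoC (mu0 * mu) * ((E0 * T (q + 1 / 2)%R * (- t / eta2)
      - E0 * T (q - 1 / 2)%R * (- t / eta2)) / dt)
    = E0 * T q * (- (2 * Ci * s * RtoC (mu0 * mu) * t / (eta2 * dt))))%C).
{ intros q.
  transitivity (RtoC (mu0 * mu) * E0 * (- t / eta2) / dt
                * (T (q + 1 / 2)%R - T (q - 1 / 2)%R))%C;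
    [field; auto | rewrite Hdiff; field; auto]. }
split.
- intros [H0 [Hcont Hf]].
  (* Reading [H0] off the transmitted wave leaves only [t] on the magnetic side of Faraday's law. *)
  assert (HH : forall q, half_integer q -> H0 q = (E0 * T q * (- t / eta2))%C)
    by (intros q Hq; rewrite <- Hb; symmetry; apply Hcont, Hq).
  assert (HEq : (E0 * T 0 <> 0)%C) by (apply Cmult_neq_0; auto).
  split.
  + destruct (Hcont 0 half_integer_0) as [Hl Hr].
    rewrite <- Hr, Ha, Hb in Hl; apply Cmult_eq_reg_l in Hl; [|exact HEq].
    transitivity (- (eta1 * eta2) * ((r - 1) / eta1))%C;
      [| rewrite Hl]; field; auto.
  + pose proof (Hf 0 half_integer_0) as Hq; simpl in Hq.
    (* The numerators 1 and -1 belong to the magnetic times [0 + 1 / 2] and [0 - 1 / 2]. *)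
    rewrite Hm, Hp, !HH, Hfar in Hq by (exists 1%Z + exists (-1)%Z; lra).
    apply (Cmult_eq_reg_l (E0 * T 0)%C); [exact HEq|].
    apply (f_equal (fun z => z * (eta2 * dx))%C) in Hq.
    transitivity (E0 * T 0 * (t * v2) * eta2
      - (E0 * T 0 * (t * v2) - E0 * T 0 * (u1 + r * v1)) / dx * (eta2 * dx))%C;
      [field; auto | rewrite <- Hq; field; auto].
- intros [Hc Hf].
  exists (fun q => E0 * T q * (- t / eta2))%C; split.
  + intros q _; split; [| apply Hb].
    rewrite Ha; f_equal.
    transitivity (- (eta2 * (1 - r)) / (eta1 * eta2))%C;
      [| rewrite Hc]; field; auto.
  + intros q _; rewrite Hm, Hp, Hfar.
    transitivity (E0 * T q * (t * v2 * eta2 - eta2 * (u1 + r * v1)) / (eta2 * dx))%C;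
      [rewrite Hf |]; field; auto.
Qed.

(** Dispersion fixes only the sines, so the signs of the cosines stay free: for [eps1 = eps2] and
    opposite cosines the denominator is zero, a case excluded by hypothesis. *)
Theorem theorem3 :
  forall (eps0 mu0 eps1 eps2 mu dt dx omega : R),
    0 < eps0 -> 0 < mu0 -> 0 < eps1 -> 0 < eps2 -> 0 < mu -> 0 < dt -> 0 < dx ->
  forall E0 k1 k2 : C,
    E0 <> RtoC 0 ->
    yee_dispersion eps0 mu0 eps1 mu dt dx omega k1 ->
    yee_dispersion eps0 mu0 eps2 mu dt dx omega k2 ->
    let eta1 := impedance eps0 mu0 eps1 mu in
    let eta2 := impedance eps0 mu0 eps2 mu in
    fresnel_denominator dx eta1 eta2 k1 k2 <> RtoC 0 ->
  forall t r : C,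
    interface_conditions mu0 mu dt dx omega eta1 eta2 E0 k1 k2 t r <->
    (t = 2 * eta2 * Ccos (k1 * dx / 2) /
         (eta2 * Ccos (k2 * dx / 2) + eta1 * Ccos (k1 * dx / 2)))%C /\
    (r = (eta2 * Ccos (k2 * dx / 2) - eta1 * Ccos (k1 * dx / 2)) /
         (eta2 * Ccos (k2 * dx / 2) + eta1 * Ccos (k1 * dx / 2)))%C.
Proof.
intros eps0 mu0 eps1 eps2 mu dt dx omega he0 hm0 he1 he2 hm ht hx E0 k1 k2 hE
  Hk1 Hk2 eta1 eta2 Hden t r.
assert (h1 : 0 < eta1) by (apply impedance_gt0; assumption).
assert (h2 : 0 < eta2) by (apply impedance_gt0; assumption).
apply yee_dispersion_impedance in Hk1, Hk2; try assumption.
fold eta1 in Hk1; fold eta2 in Hk2.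
rewrite interface_conditions_reduced by (assumption || lra).
(* The common grid term becomes [eta2] times the second sine, both in the first dispersion relation
   and in the Faraday coefficient. *)
rewrite <- Hk2 in Hk1 |- *.
rewrite !Cexp_Ci, !Cexp_opp_Ci.
unfold fresnel_denominator in Hden.
set (c1 := Ccos (k1 * dx / 2)) in *; set (c2 := Ccos (k2 * dx / 2)) in *.
set (s1 := Csin (k1 * dx / 2)) in *; set (s2 := Csin (k2 * dx / 2)) in *.
assert (h2' : RtoC eta2 <> RtoC 0) by (intros H; apply RtoC_inj in H; lra).
clearbody c1 c2 s1 s2.
(* An identity for the difference of the two sides of (b) serves both directions of the
   equivalence. *)
assert (Hsine : (eta2 * (1 - r) = eta1 * t)%C ->
  (eta2 * (c1 + Ci * s1 + r * (c1 - Ci * s1)) - (eta2 * (c2 - Ci * s2)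
     + 2 * Ci * (eta2 * s2)) * t = eta2 * ((1 + r) * c1 - c2 * t))%C).
{ intros Hc.
  transitivity (eta2 * ((1 + r) * c1 - c2 * t)
    + Ci * (eta2 * (1 - r) * s1 - t * (eta2 * s2)))%C; [ring |].
  rewrite Hc, <- Hk1; ring. }
split.
- intros [Hc Hf].
  specialize (Hsine Hc); rewrite Hf in Hsine.
  assert (Hcos : ((1 + r) * c1 = c2 * t)%C).
  { apply (Cmult_eq_reg_l eta2); [exact h2' |].
    transitivity (eta2 * ((1 + r) * c1 - c2 * t) + eta2 * (c2 * t))%C;
      [| rewrite <- Hsine]; ring. }
  assert (Ht : t = (2 * eta2 * c1 / (eta2 * c2 + eta1 * c1))%C).
  { apply (Cmult_eq_reg_l (eta2 * c2 + eta1 * c1)%C); [exact Hden |].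
    (* Eliminates [r]: the two summands become [eta2 * (1 + r) * c1] and [eta2 * (1 - r) * c1]. *)
    transitivity (eta2 * (c2 * t) + c1 * (eta1 * t))%C; [ring |].
    rewrite <- Hcos, <- Hc; field; exact Hden. }
  split; [exact Ht |].
  transitivity (1 - eta2 * (1 - r) / eta2)%C; [field; exact h2' |].
  rewrite Hc, Ht; field; auto.
- intros [Ht Hr].
  assert (Hc : (eta2 * (1 - r) = eta1 * t)%C) by (rewrite Ht, Hr; field; auto).
  split; [exact Hc |].
  specialize (Hsine Hc).
  assert (Hcos : ((1 + r) * c1 - c2 * t = 0)%C) by (rewrite Ht, Hr; field; auto).
  rewrite Hcos, Cmult_0_r in Hsine.
  (* [Hsine] now says that the two sides of (b) differ by zero. *)
  match type of Hsine with (?a - ?b = _)%C =>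
    transitivity (a - b + b)%C; [ring | rewrite Hsine; ring] end.
Qed.
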